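(* Let $a,b>0$, $n\in\mathbb{N}$ (so $n\ge1$) and $v\in\mathbb{R}$. (i) If $v\notin\left[0,\frac1{2^n}\right]$, then $$\frac{a+b}2\le H_v(a,b)+v\sum_{k=1}^n2^{k-2}\left\{\left(\sqrt a-\sqrt[2^k]{a^{2^{k-1}-1}b}\right)^2+\left(\sqrt b-\sqrt[2^k]{ab^{2^{k-1}-1}}\right)^2\right\}.$$ (ii) If $v\notin\left[\frac{2^n-1}{2^n},1\right]$, then $$\frac{a+b}2\le H_v(a,b)+(1-v)\sum_{k=1}^n2^{k-2}\left\{\left(\sqrt a-\sqrt[2^k]{a^{2^{k-1}-1}b}\right)^2+\left(\sqrt b-\sqrt[2^k]{ab^{2^{k-1}-1}}\right)^2\right\}.$$
   Context: For $a,b>0$ and $v\in\mathbb{R}$, $H_v(a,b)=\dfrac{a^{1-v}b^v+a^vb^{1-v}}{2}$. All powers and roots are the usual real ones of positive real numbers; $\sqrt[m]{x}=x^{1/m}$. *)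

(* Defs.v *)
From mathcomp Require Import all_boot all_order all_algebra.
From mathcomp Require Import all_classical all_reals all_analysis.
Set Implicit Arguments.
Unset Strict Implicit.
Unset Printing Implicit Defensive.
Import Order.TTheory GRing.Theory Num.Theory.
Local Open Scope ring_scope.

(* Heinz mean; [x `^ y] is [expR (y * ln x)] when [x > 0]. *)
Definition heinz (R : realType) (v a b : R) : R :=
  (a `^ (1 - v) * b `^ v + a `^ v * b `^ (1 - v)) / 2.

Definition nroot (R : realType) (m : nat) (x : R) : R := x `^ (m%:R^-1).

(* The prefactor 2^(k-2) is an integer power, as it equals 1/2 at k = 1;
   the natural-number subtractions are only used for 1 <= k, where they do
   not truncate. *)
Definition heinz_term (R : realType) (a b : R) (k : nat) : R :=
  2 ^ (k%:Z - 2) *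
  ((Num.sqrt a - nroot (2 ^ k)%N (a ^+ (2 ^ (k - 1) - 1)%N * b)) ^+ 2 +
   (Num.sqrt b - nroot (2 ^ k)%N (a * b ^+ (2 ^ (k - 1) - 1)%N)) ^+ 2).

(* Main.v *)
Require Import Defs.
From mathcomp Require Import all_boot all_order all_algebra.
From mathcomp Require Import all_classical all_reals all_analysis.
From mathcomp Require Import ring lra.
Set Implicit Arguments.
Unset Strict Implicit.
Unset Printing Implicit Defensive.
Import Order.TTheory GRing.Theory Num.Theory.
Local Open Scope ring_scope.

(** The Heinz mean [t |-> heinz t a b] is convex, takes the value
    [(a + b) / 2] at [t = 0] and is symmetric about [1 / 2].

    Expanding the squares, the [k]-th term of the sum is a combination of
    Heinz means at [0], [2^-k] and [2^-(k-1)] ([heinz_term_diff]), and these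
    combinations telescope ([sum_heinz_term]): with [h = 2^-n], the sum is
    [(heinz 0 a b - heinz h a b) / h].  Hence the right-hand side of (i) is
    [heinz v a b] minus the increment at [v] of the secant line through the
    points of abscissae [0] and [h], and (i) says that a convex function lies
    above its secant outside the interval where the secant is drawn
    ([heinz_secant]).

    Part (ii) is part (i) at [1 - v], by symmetry. *)

Lemma powR_interp_expR (R : realType) (x y t : R) :
  expR x `^ (1 - t) * expR y `^ t = expR ((1 - t) * x + t * y).
Proof. by rewrite -!expRM -expRD; congr expR; ring. Qed.

(** Convexity of [t |-> expR (x + t * c)], outside the interval between the
    two nodes [0] and [h].  Both cases combine two instances of
    [1 + z <= expR z], i.e. the tangent line at the middle one of the points
    [0], [h], [v]. *)
Lemma expR_secant (R : realType) (x c h v : R) : 0 < h -> v < 0 \/ h < v ->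
  v * (expR (x + h * c) - expR x) <= h * (expR (x + v * c) - expR x).
Proof.
move=> h0 hv; rewrite !expRD.
suff H : v * (expR (h * c) - 1) <= h * (expR (v * c) - 1).
  have := ler_wpM2l (expR_ge0 x) H; lra.
case: hv => hv.
- have := ler_wpM2l (ltW h0) (expR_ge1Dx (v * c)).
  have v0 : 0 <= - v by lra.
  have := ler_wpM2l v0 (expR_ge1Dx (h * c)); lra.
- have -> : v * c = h * c + (v - h) * c by ring.
  rewrite expRD; set E := expR (h * c).
  have A : E * (1 + (v - h) * c) <= E * expR ((v - h) * c).
    by rewrite ler_pM2l ?expR_gt0 ?expR_ge1Dx.
  have B : E * (1 - h * c) <= 1.
    by rewrite -[leRHS](expRxMexpNx_1 (h * c)) ler_pM2l ?expR_gt0 ?expR_ge1Dx.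
  have vh : 0 <= v - h by lra.
  have := ler_wpM2l (ltW h0) A; have := ler_wpM2l vh B; lra.
Qed.

(** Both products are exponentials of affine functions of [t], which reduces
    the convexity of the Heinz mean to that of the exponential. *)
Lemma heinz_expR (R : realType) (a b t : R) : 0 < a -> 0 < b ->
  heinz t a b = (expR (ln a + t * (ln b - ln a)) +
                 expR (ln b + t * (ln a - ln b))) / 2.
Proof.
move=> a0 b0; rewrite /heinz -{1 2}(lnK a0) -{1 2}(lnK b0).
rewrite powR_interp_expR [X in _ + X]mulrC powR_interp_expR.
by congr ((expR _ + expR _) / _); ring.
Qed.

Lemma heinz_secant (R : realType) (a b h v : R) :
  0 < a -> 0 < b -> 0 < h -> v < 0 \/ h < v ->
  v * (heinz h a b - heinz 0 a b) <= h * (heinz v a b - heinz 0 a b).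
Proof.
move=> a0 b0 h0 hv; rewrite !heinz_expR // !mul0r !addr0.
have := expR_secant (ln a) (ln b - ln a) h0 hv.
have := expR_secant (ln b) (ln a - ln b) h0 hv.
lra.
Qed.

Lemma heinz0 (R : realType) (a b : R) : 0 < a -> 0 < b ->
  heinz 0 a b = (a + b) / 2.
Proof.
by move=> a0 b0; rewrite /heinz subr0 !powRr0 !powRr1 ?ltW // mulr1 mul1r.
Qed.

Lemma heinz_sym (R : realType) (v a b : R) : heinz (1 - v) a b = heinz v a b.
Proof. by rewrite /heinz subKr addrC. Qed.

(** With [h = 2^-(k+1)], the root is [a `^ (1/2 - h) * b `^ h], so the square
    produces the weighted geometric means of weights [0], [h] and [2 h]. *)
Lemma sqr_sqrt_sub_nroot (R : realType) (a b : R) (k : nat) :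
  0 < a -> 0 < b ->
  let h := 2^-1 ^+ k.+1 in
  (Num.sqrt a - nroot (2 ^ k.+1)%N (a ^+ (2 ^ k - 1)%N * b)) ^+ 2 =
  a - 2 * (a `^ (1 - h) * b `^ h) + a `^ (1 - 2 * h) * b `^ (2 * h).
Proof.
move=> a0 b0 h; rewrite /nroot -(lnK a0) -(lnK b0).
set x := ln a; set y := ln b.
rewrite !powR_interp_expR -powR12_sqrt ?expR_ge0 //.
rewrite -expRM_natl -expRD -!expRM sqrrB !expr2 -!expRD -[expR _ *+ 2]mulr_natl.
have hE : (2 ^ k.+1)%:R^-1 = h :> R by rewrite /h natrX exprVn.
have hk : (2 ^ k)%:R * h = 2^-1.
  by rewrite natrX /h exprVn exprS invfM mulrCA mulfV ?mulr1 // expf_neq0 ?pnatr_eq0.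
have -> : ((2 ^ k - 1)%:R * x + y) / (2 ^ k.+1)%:R = (2^-1 - h) * x + h * y.
  by rewrite hE natrB ?expn_gt0 // -hk; ring.
by congr (expR _ - _ * expR _ + expR _); field.
Qed.

(** In this form, the successive terms telescope in [k]. *)
Lemma heinz_term_diff (R : realType) (a b : R) (k : nat) : 0 < a -> 0 < b ->
  heinz_term a b k.+1 =
    2 ^+ k.+1 * (heinz 0 a b - heinz (2^-1 ^+ k.+1) a b) -
    2 ^+ k * (heinz 0 a b - heinz (2^-1 ^+ k) a b).
Proof.
move=> a0 b0; rewrite heinz0 // /heinz_term subSS subn0.
have -> : 2 ^ (k.+1%:Z - 2) = 2^-1 * 2 ^+ k :> R.
  have -> : k.+1%:Z - 2 = k%:Z - 1 by rewrite -addn1 PoszD; ring.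
  by rewrite expfzDr ?pnatr_eq0 // mulrC.
rewrite sqr_sqrt_sub_nroot // (mulrC a) sqr_sqrt_sub_nroot //.
have -> : 2 * 2^-1 ^+ k.+1 = 2^-1 ^+ k :> R.
  by rewrite exprS mulrA mulfV ?mul1r ?pnatr_eq0.
rewrite /heinz (exprS 2); move: (2^-1 ^+ k.+1) (2^-1 ^+ k) => h h'.
by field.
Qed.

Lemma sum_heinz_term (R : realType) (a b : R) (n : nat) : 0 < a -> 0 < b ->
  \sum_(1 <= k < n.+1) heinz_term a b k =
    2 ^+ n * (heinz 0 a b - heinz (2^-1 ^+ n) a b).
Proof.
move=> a0 b0; rewrite big_add1 /=.
under eq_bigr do rewrite heinz_term_diff //.
(* The initial term of the telescope vanishes as the Heinz means at [0] and
   [1] agree. *)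
rewrite telescope_sumr // expr0 expr0 -(heinz_sym 1) !subrr.
by rewrite mulr0 subr0.
Qed.

Lemma heinz_lower_bound (R : realType) (a b v : R) (n : nat) :
  0 < a -> 0 < b -> v \notin `[0, 1 / 2 ^+ n] ->
  (a + b) / 2 <= heinz v a b + v * \sum_(1 <= k < n.+1) heinz_term a b k.
Proof.
move=> a0 b0; rewrite in_itv /= negb_and -!ltNge div1r -exprVn => /orP hv.
have h0 : 0 < 2^-1 ^+ n :> R by rewrite exprn_gt0 ?invr_gt0 ?ltr0n.
have N0 : 0 <= 2 ^+ n :> R by rewrite exprn_ge0 ?ler0n.
have Nh : 2 ^+ n * 2^-1 ^+ n = 1 :> R by rewrite -exprMn mulfV ?expr1n ?pnatr_eq0.
have := ler_wpM2l N0 (heinz_secant a0 b0 h0 hv).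
rewrite [leRHS]mulrA Nh mul1r sum_heinz_term // heinz0 //; lra.
Qed.

Theorem corollary5 (R : realType) (a b v : R) (n : nat)
    (ha : 0 < a) (hb : 0 < b) (hn : (1 <= n)%N) :
  (v \notin `[0, 1 / 2 ^+ n] ->
     (a + b) / 2 <=
       heinz v a b + v * \sum_(1 <= k < n.+1) heinz_term a b k) /\
  (v \notin `[(2 ^+ n - 1) / 2 ^+ n, 1] ->
     (a + b) / 2 <=
       heinz v a b + (1 - v) * \sum_(1 <= k < n.+1) heinz_term a b k).
Proof.
split=> hv; first exact: heinz_lower_bound.
rewrite -(heinz_sym v); apply: heinz_lower_bound => //.
apply: contra hv; rewrite !in_itv /= mulrBl mulfV ?expf_neq0 ?pnatr_eq0 //.
by move=> /andP[h0 h1]; apply/andP; split; lra.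
Qed.
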